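(* Let $q>3$ be an odd prime power. Then the general linear group $\mathrm{GL}_2(q)$ has a solvabilizer covering of size $q$. Specifically, if $q\equiv 1 \pmod 4$, then the simple group $\mathrm{PSL}_2(q)$ has a solvabilizer covering of size $q$; in other words, $\alpha(\mathrm{PSL}_2(q))\le q$ holds for $q\equiv 1\pmod 4$.
   Context: For a finite group $G$, $R(G)$ denotes the solvable radical of $G$ (the largest solvable normal subgroup). For $x\in G$, the solvabilizer of $x$ is $\mathrm{Sol}_G(x)=\{y\in G\mid \langle x,y\rangle \text{ is solvable}\}$. For nonsolvable $G$, a solvabilizer covering of $G$ is a set $X\subset G\setminus R(G)$ such that $G=\bigcup_{x\in X}\mathrm{Sol}_G(x)$, and the solvabilizer number $\alpha(G)$ is the minimum cardinality of a solvabilizer covering of $G$. *)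

(* Defs.v *)
From HB Require Import structures.
From mathcomp Require Import all_boot all_order all_algebra.
From mathcomp Require Import all_fingroup all_solvable.

Set Implicit Arguments.
Unset Strict Implicit.
Unset Printing Implicit Defensive.

Import GroupScope.

Section Solvabilizer.

Variable gT : finGroupType.
Implicit Types (G H : {group gT}) (X : {set gT}).

Lemma solvableY G H :
  H \subset 'N(G) -> solvable G -> solvable H -> solvable (G <*> H).
Proof.
move=> nGH solG solH; have nGJ : G <| G <*> H by rewrite normalYl.
by rewrite (series_sol nGJ) solG /= quotientYidl // quotient_sol.
Qed.

(* Generated by all solvable normal subgroups of G; [sol_radical_sol],
   [sol_radical_normal] and [sol_radical_max] show that it is the largest. *)
Definition sol_radical (G : {set gT}) : {set gT} :=
  <<\bigcup_(H : {group gT} | (H <| G) && solvable H) H>>.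

Canonical sol_radical_group G := Eval hnf in [group of sol_radical G].

Lemma sol_radical_max G H : H <| G -> solvable H -> H \subset sol_radical G.
Proof.
move=> nHG solH; apply: sub_gen; apply: bigcup_sup; exact/andP.
Qed.

Lemma sol_radical_normal_sol G :
  (sol_radical G <| G) && solvable (sol_radical G).
Proof.
have [M /maxgroupP[/andP[nMG solM] maxM] _] :
    {M : {group gT} | [max M | (M <| G) && solvable M] & 1%G \subset M}.
  by apply: maxgroup_exists; rewrite normal1 solvable1.
suff -> : sol_radical G = M by rewrite nMG.
apply/eqP; rewrite eqEsubset sol_radical_max // andbT.
rewrite gen_subG; apply/bigcupsP=> H /andP[nHG solH].
have nMH : H \subset 'N(M) := subset_trans (normal_sub nHG) (normal_norm nMG).
have solJ : solvable (M <*> H).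
  exact: solvableY.
have nJG : M <*> H <| G by apply: normalY.
rewrite -(maxM (M <*> H)%G) ?joing_subr ?joing_subl //.
by apply/andP.
Qed.

Lemma sol_radical_normal G : sol_radical G <| G.
Proof. by case/andP: (sol_radical_normal_sol G). Qed.

Lemma sol_radical_sol G : solvable (sol_radical G).
Proof. by case/andP: (sol_radical_normal_sol G). Qed.

Definition solvabilizer (G : {set gT}) (x : gT) : {set gT} :=
  [set y in G | solvable <<[set x; y]>>].

(* No X satisfies this when G is solvable, see [sol_covering_nonsolvable]. *)
Definition sol_covering (G X : {set gT}) : bool :=
  (X \subset G :\: sol_radical G) && (G == \bigcup_(x in X) solvabilizer G x).

Lemma sol_covering_nonsolvable G X : sol_covering G X -> ~~ solvable G.
Proof.
case/andP=> sX /eqP defG; apply/negP=> solG.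
have RG : G \subset sol_radical G by exact: sol_radical_max.
have X0 : X = set0.
  by apply/eqP; rewrite -subset0; apply: subset_trans sX _; rewrite subset0 setD_eq0.
by move: (group1 G); rewrite defG X0 big_set0 inE.
Qed.

Lemma sol_covering_setD G :
  ~~ solvable G -> sol_covering G (G :\: sol_radical G).
Proof.
move=> nsolG; rewrite /sol_covering subxx eqEsubset /=; apply/andP; split.
  apply/subsetP=> y Gy; apply/bigcupP.
  have [Ry | nRy] := boolP (y \in sol_radical G); last first.
    by exists y; rewrite inE ?nRy // Gy setUid; apply/abelian_sol/cycle_abelian.
  have [x Gx nRx] : exists2 x, x \in G & x \notin sol_radical G.
    apply/subsetPn; apply: contra nsolG => sGR.
    exact: solvableS sGR (sol_radical_sol G).
  exists x; first by rewrite inE nRx.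
  rewrite inE Gy /=.
  have nRx' : <[x]> \subset 'N(sol_radical G).
    by rewrite cycle_subG (subsetP (normal_norm (sol_radical_normal G))).
  have solJ : solvable (sol_radical G <*> <[x]>).
    apply: solvableY => //; first exact: sol_radical_sol.
    exact/abelian_sol/cycle_abelian.
  apply: solvableS solJ; rewrite gen_subG subUset !sub1set.
  by rewrite !mem_gen // inE ?Ry ?cycle_id ?orbT.
by apply/bigcupsP=> x _; apply/subsetP=> y /[!inE] /andP[].
Qed.

(* The default G :\: sol_radical G is a covering when G is nonsolvable
   ([sol_covering_setD]); for solvable G the value is meaningless. *)
Definition sol_number (G : {set gT}) : nat :=
  #|[arg min_(X < G :\: sol_radical G | sol_covering G X) #|X|]|.

Lemma sol_number_le G X : sol_covering G X -> sol_number G <= #|X|.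
Proof.
move=> covX; rewrite /sol_number; case: arg_minnP => [|Y _]; last exact.
exact: sol_covering_setD (sol_covering_nonsolvable covX).
Qed.

Lemma sol_number_exists G :
  ~~ solvable G -> exists2 X, sol_covering G X & #|X| = sol_number G.
Proof.
move=> nsolG; rewrite /sol_number.
by case: arg_minnP => [|Y covY _]; [exact: sol_covering_setD | exists Y].
Qed.

End Solvabilizer.

Section SpecialLinear.

Variables (n : nat) (F : finComUnitRingType).

Definition SLgroup : {set {'GL_n[F]}} :=
  [set u : {'GL_n[F]} | (\det (GLval u) == 1)%R].

Lemma SLgroup_group_set : group_set SLgroup.
Proof.
apply/group_setP; split=> [|u v]; first by rewrite inE GL_1E det1.
by rewrite !inE GL_ME det_mulmx => /eqP-> /eqP->; rewrite GRing.mulr1.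
Qed.

Canonical SLgroup_group := group SLgroup_group_set.

Definition PSLgroup : {set coset_of 'Z(SLgroup)} := SLgroup / 'Z(SLgroup).

Canonical PSLgroup_group := Eval hnf in [group of PSLgroup].

End SpecialLinear.

Arguments SLgroup n%_N F%_type.
Arguments PSLgroup n%_N F%_type.

Notation "''SL_' n [ F ]" := (SLgroup n F)
  (at level 8, n at level 2, format "''SL_' n [ F ]") : group_scope.
Notation "''PSL_' n [ F ]" := (PSLgroup n F)
  (at level 8, n at level 2, format "''PSL_' n [ F ]") : group_scope.

(* Main.v *)
Require Import Defs.
From mathcomp Require Import all_boot all_order all_algebra.
From mathcomp Require Import all_fingroup all_solvable.
From mathcomp Require Import ring.

Import GRing.Theory GroupScope.

(* The traceless matrices X_b = [[1, b], [0, -1]] form, up to scalars, the line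
   of the plane P(sl_2) tangent at E_12 to the conic det = 0, with the point
   E_12 removed.  If y is upper triangular, it generates with any X_b a
   subgroup of the Borel group.  Otherwise y has a nonzero lower left entry,
   so that tr (X_b y) = 0 for exactly one b; then X_b y X_b^-1 is the adjugate
   (det y) y^-1, and <X_b, y> is abelian-by-cyclic.  When q = 1 mod 4 we have
   -1 = i^2 in F, and the i X_b have determinant 1.  They avoid the radical,
   because the commutators of X_b with transvections are transvections, so
   that a normal subgroup containing some i X_b contains the perfect group
   generated by all elementary matrices. *)

(** * Solvability criteria *)

Section SolvablePairs.

Variable gT : finGroupType.
Implicit Types (G H N : {group gT}) (x y z : gT).

(** Turns a commutator formula into an identity free of inverses, which can be checked on matrix
    entries. *)
Lemma mulg_commg x y z : x * y = y * x * z -> [~ x, y] = z.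
Proof. by rewrite commgC => /mulgI. Qed.

(** The group [A] generated by y and z is abelian. Conjugation by x fixes z and sends y to z y^-1,
    so it preserves [A], and [A <*> <[x]>] is abelian-by-cyclic. *)
Lemma solvable_gen_invert x y z :
    commute x z -> commute y z -> y ^ x = z * y^-1 ->
  solvable <<[set x; y]>>.
Proof.
move=> cxz cyz yx; pose A : {group gT} := <<[set y; z]>>%G.
have Ay : y \in A by rewrite mem_gen // !inE eqxx.
have Az : z \in A by rewrite mem_gen // !inE eqxx orbT.
have abA : abelian A.
  rewrite abelian_gen; apply/centsP=> u /[!inE] uyz v /[!inE] vyz.
  by case/orP: uyz => /eqP->; case/orP: vyz => /eqP->.
have nAx : <[x]> \subset 'N(A).
  rewrite cycle_subG inE -genJ gen_subG; apply/subsetP=> _ /imsetP[u + ->].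
  rewrite !inE => /orP[]/eqP->; first by rewrite yx groupM ?groupV.
  by rewrite conjgE -cxz mulKg.
have solJ := solvableY nAx (abelian_sol abA) (abelian_sol (cycle_abelian x)).
apply: solvableS solJ; rewrite gen_subG subUset !sub1set.
by rewrite !mem_gen // inE ?cycle_id ?Ay ?orbT.
Qed.

Lemma solvable_commg_abelian G (U : {set gT}) :
  abelian U -> {in G &, forall x y, [~ x, y] \in U} -> solvable G.
Proof.
move=> abU GU; have sG'U : G^`(1) \subset <<U>>.
  by rewrite genS //; apply/subsetP=> _ /imset2P[x y Gx Gy ->]; apply: GU.
rewrite (series_sol (der_normal 1 G)) (abelian_sol (der_abelian 0 G)) andbT.
by apply: solvableS sG'U _; rewrite abelian_sol ?abelian_gen.
Qed.

Lemma quotient_gen2 H x y :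
    x \in 'N(H) -> y \in 'N(H) ->
  <<[set coset H x; coset H y]>> = <<[set x; y]>> / H.
Proof.
move=> Nx Ny; rewrite quotient_gen ?subUset ?sub1set ?Nx //.
by rewrite quotientU !quotient_set1.
Qed.

Lemma cosetpre_sol H (K : {group coset_of H}) :
  solvable H -> solvable K -> solvable (coset H @*^-1 K).
Proof.
move=> solH solK; rewrite (series_sol (normal_cosetpre K)) solH.
by rewrite cosetpreK.
Qed.

End SolvablePairs.

(** * Invertible 2 x 2 matrices by their entries *)

Section GL2.

Local Open Scope ring_scope.

Variable F : finFieldType.

(* A rigid name for the group instance: with {'GL_2[F]} itself, unifying its
   various group structures dominates the checking time. *)
Definition GL2 : finGroupType := {'GL_2[F]}.

Implicit Types (a b c d t : F) (u v : GL2).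

(* The identity when a d = b c. *)
Definition gl2 a b c d : GL2 :=
  insubd (1%g : {'GL_2[F]})
    (\matrix_(i, j) if i == 0 then if j == 0 then a else b
                    else if j == 0 then c else d).

Definition e00 u : F := GLval u 0 0.
Definition e01 u : F := GLval u 0 1.
Definition e10 u : F := GLval u 1 0.
Definition e11 u : F := GLval u 1 1.

Lemma det_mx22 (A : 'M[F]_2) : \det A = A 0 0 * A 1 1 - A 0 1 * A 1 0.
Proof.
rewrite (expand_det_row _ 0) !big_ord_recl big_ord0 /cofactor !det_mx11 !mxE /=.
rewrite (_ : lift 0 0 = 1); last exact: val_inj.
rewrite (_ : lift 1 0 = 0); last exact: val_inj.
by rewrite expr0 expr1; ring.
Qed.

Lemma GL2_det_neq0 u : e00 u * e11 u - e01 u * e10 u != 0.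
Proof. by rewrite -[_ - _]det_mx22 (GL_det u). Qed.

Lemma in_SL2 u : (u \in 'SL_2[F]) = (e00 u * e11 u - e01 u * e10 u == 1).
Proof. by rewrite inE det_mx22. Qed.

Lemma GL2_ext u v :
  e00 u = e00 v -> e01 u = e01 v -> e10 u = e10 v -> e11 u = e11 v -> u = v.
Proof.
move=> h00 h01 h10 h11; apply: val_inj; apply/matrixP=> i j.
have ord2 (k : 'I_2) : k = 0 \/ k = 1.
  by case: k => [[|[|//]] ?]; [left | right]; apply: val_inj.
by case: (ord2 i) => ->; case: (ord2 j) => ->.
Qed.

Lemma gl2E a b c d : a * d - b * c != 0 ->
  (e00 (gl2 a b c d) = a) * (e01 (gl2 a b c d) = b)
  * (e10 (gl2 a b c d) = c) * (e11 (gl2 a b c d) = d).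
Proof.
move=> nz; suff E : GLval (gl2 a b c d) =
    \matrix_(i, j) if i == 0 then if j == 0 then a else b
                   else if j == 0 then c else d.
  by rewrite /e00 /e01 /e10 /e11 E !mxE.
by apply: insubdK; rewrite -topredE /= unitmxE unitfE (det_mx22 _) !mxE.
Qed.

Lemma GL2_mulE u v :
  (e00 (u * v)%g = e00 u * e00 v + e01 u * e10 v)
  * (e01 (u * v)%g = e00 u * e01 v + e01 u * e11 v)
  * (e10 (u * v)%g = e10 u * e00 v + e11 u * e10 v)
  * (e11 (u * v)%g = e10 u * e01 v + e11 u * e11 v).
Proof.
have ord1 : lift ord0 ord0 = 1 :> 'I_2 by apply: val_inj.
rewrite /e00 /e01 /e10 /e11 !GL_MxE !mxE !big_ord_recl !big_ord0 !addr0.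
by rewrite !ord1.
Qed.

Lemma GL2_1E :
  (e00 1%g = 1) * (e01 1%g = 0) * (e10 1%g = 0) * (e11 1%g = 1).
Proof. by rewrite /e00 /e01 /e10 /e11 GL_1E !mxE. Qed.

(** * Transvections, diagonal matrices and their commutators *)

Definition upper t : GL2 := gl2 1 t 0 1.
Definition lower t : GL2 := gl2 1 0 t 1.
Definition diag a : GL2 := gl2 a 0 0 a^-1.
(** This is c X_b, of determinant - c^2: c = 1 serves for GL_2, and a square root c of -1 brings it
    into SL_2. *)
Definition refl c b : GL2 := gl2 c (c * b) 0 (- c).

Arguments upper t%_R.
Arguments lower t%_R.
Arguments diag a%_R.
Arguments refl (c b)%_R.

Lemma upperE t : (e00 (upper t) = 1) * (e01 (upper t) = t)
  * (e10 (upper t) = 0) * (e11 (upper t) = 1).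
Proof. by apply: gl2E; rewrite mulr1 mulr0 subr0 oner_eq0. Qed.

Lemma lowerE t : (e00 (lower t) = 1) * (e01 (lower t) = 0)
  * (e10 (lower t) = t) * (e11 (lower t) = 1).
Proof. by apply: gl2E; rewrite mulr1 mul0r subr0 oner_eq0. Qed.

Lemma diagE a : a != 0 -> (e00 (diag a) = a) * (e01 (diag a) = 0)
  * (e10 (diag a) = 0) * (e11 (diag a) = a^-1).
Proof. by move=> a0; apply: gl2E; rewrite mulr0 subr0 divff ?oner_eq0. Qed.

Lemma reflE c b : c != 0 -> (e00 (refl c b) = c) * (e01 (refl c b) = c * b)
  * (e10 (refl c b) = 0) * (e11 (refl c b) = - c).
Proof. by move=> c0; apply: gl2E; rewrite mulr0 subr0 mulf_neq0 ?oppr_eq0. Qed.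

Lemma upper_in_SL t : upper t \in 'SL_2[F].
Proof. by rewrite in_SL2 !upperE mulr1 mulr0 subr0. Qed.

Lemma lower_in_SL t : lower t \in 'SL_2[F].
Proof. by rewrite in_SL2 !lowerE mulr1 mul0r subr0. Qed.

Lemma commg_upper_diag a t : a != 0 ->
  [~ upper t, diag a]%g = upper (t * (a^-1 ^+ 2 - 1)).
Proof.
move=> a0; apply: mulg_commg.
by apply: GL2_ext; rewrite !GL2_mulE !upperE !diagE //; field.
Qed.

Lemma commg_lower_diag a t : a != 0 ->
  [~ lower t, diag a]%g = lower (t * (a ^+ 2 - 1)).
Proof.
move=> a0; apply: mulg_commg.
by apply: GL2_ext; rewrite !GL2_mulE !lowerE !diagE //; field.
Qed.

Lemma commg_refl_upper b c t : c != 0 -> [~ refl c b, upper t]%g = upper (t *+ 2).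
Proof.
move=> c0; apply: mulg_commg.
by apply: GL2_ext; rewrite !GL2_mulE !upperE !reflE //; ring.
Qed.

(** For nonzero a this is the monomial matrix [[0, a], [- a^-1, 0]], written as a product of
    transvections. *)
Definition weyl a : GL2 := (upper a * lower (- a^-1) * upper a)%g.

Arguments weyl a%_R.

Lemma weylM a : a != 0 -> (weyl a * weyl (-1))%g = diag a.
Proof.
move=> a0; apply: GL2_ext; rewrite !GL2_mulE !upperE !lowerE diagE // invrN1.
all: by field.
Qed.

Lemma upperJ_weyl t : (upper t ^ weyl 1)%g = lower (- t).
Proof.
apply: (mulgI (weyl 1)); rewrite -conjgC.
by apply: GL2_ext; rewrite !GL2_mulE !upperE !lowerE invr1; ring.
Qed.

(** * The group generated by transvections, and nonsolvability *)

Definition elementary : {group GL2} :=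
  <<[set upper t | t : F] :|: [set lower t | t : F]>>%G.

Lemma upper_elementary t : upper t \in elementary.
Proof. by rewrite mem_gen // inE imset_f. Qed.

Lemma lower_elementary t : lower t \in elementary.
Proof. by rewrite mem_gen // inE imset_f ?orbT. Qed.

Lemma elementary_subG (N : {group GL2}) :
  (forall t, upper t \in N) -> (forall t, lower t \in N) -> elementary \subset N.
Proof.
move=> NU NL; rewrite gen_subG; apply/subsetP=> u.
by rewrite inE => /orP[] /imsetP[t _ ->].
Qed.

(** The group is perfect: taking the commutator with [diag a] rescales the parameter of a
    transvection by a^-2 - 1 or a^2 - 1, which is invertible once a^2 differs from 0 and 1. *)
Lemma elementary_nonsolvable : (3 < #|F|)%N -> ~~ solvable elementary.
Proof.
move=> F3; have [a a0 a1] : exists2 a : F, a != 0 & a ^+ 2 != 1.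
  (* The values to avoid are 0, 1 and -1, at most three in number. *)
  have /subsetPn[a _] : ~~ ([set: F] \subset (0 |: (1 |: [set -1]))).
    apply: contraL F3 => /subset_leq_card; rewrite cardsT -leqNgt => /leq_trans; apply.
    by rewrite cardsU1 cardsU1 cards1; do 2!case: (_ \notin _).
  rewrite !inE !negb_or => /and3P[a0 a1 a1']; exists a => //.
  by rewrite sqrf_eq1 negb_or a1.
have hE : diag a \in elementary.
  by rewrite -weylM // !groupM ?upper_elementary ?lower_elementary.
have a2 : a ^+ 2 - 1 != 0 by rewrite subr_eq0.
have a2' : a^-1 ^+ 2 - 1 != 0 by rewrite exprVn subr_eq0 invr_eq1.
(* Solvability is defined by the triviality of every subgroup contained in its own derived
   subgroup. *)
apply/negP=> /forall_inP/(_ elementary); rewrite subsetI subxx andTb.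
have -> : elementary \subset [~: elementary, elementary]%g.
  apply: elementary_subG => t.
    rewrite -(divfK a2' t) -commg_upper_diag //.
    by rewrite mem_commg ?upper_elementary.
  rewrite -(divfK a2 t) -commg_lower_diag //.
  by rewrite mem_commg ?lower_elementary.
move=> /(_ isT)/eqP E1; have := upper_elementary 1; rewrite E1 inE => /eqP.
by move/(congr1 e01)/eqP; rewrite upperE GL2_1E oner_eq0.
Qed.

(** By Lagrange in the additive group, #|F| times 1 is 0; if 2 = 0, oddness of #|F| would make this
    multiple equal to 1. *)
Lemma odd_char_neq2 : odd #|F| -> 2 != 0 :> F.
Proof.
move=> oddF; apply/eqP=> F2.
have : (1 : F) *+ #|F| = 0.
  by rewrite -FinRing.zmodXgE -cardsT; apply: expg_cardG (in_setT _).
rewrite -(odd_double_half #|F|) oddF mulrnDr -muln2 mulnC mulrnA F2 mul0rn addr0.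
by apply/eqP; rewrite oner_eq0.
Qed.

(** Asking only that SL_2 normalise [N] covers both the radical of GL_2 and the preimage in SL_2 of
    the radical of PSL_2. *)
Lemma nonsolvable_refl (N : {group GL2}) b c :
    odd #|F| -> (3 < #|F|)%N -> c != 0 -> 'SL_2[F] \subset 'N(N)%g ->
  refl c b \in N -> ~~ solvable N.
Proof.
move=> oddF F3 c0 nN Nx; apply: contra (elementary_nonsolvable F3).
have NU t : upper t \in N.
  (* The commutator with [refl c b] doubles the parameter, so start from t / 2. *)
  rewrite (_ : t = t / 2 *+ 2); last by field; exact: odd_char_neq2.
  rewrite -(commg_refl_upper b c) // commgEl groupM ?groupV //.
  by rewrite memJ_norm // (subsetP nN) ?upper_in_SL.
apply: solvableS; apply: elementary_subG => // t.
rewrite -[t]opprK -upperJ_weyl memJ_norm // (subsetP nN) //.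
by rewrite !groupM ?upper_in_SL ?lower_in_SL.
Qed.

(** * The Borel subgroup and solvable pairs *)

Definition borel : {set GL2} := [set u : GL2 | e10 u == 0].

Lemma borel_group_set : group_set borel.
Proof.
apply/group_setP; split=> [|u v]; first by rewrite inE GL2_1E.
by rewrite !inE GL2_mulE => /eqP-> /eqP->; rewrite mul0r mulr0 addr0.
Qed.

Canonical borel_group := group borel_group_set.

Lemma borel_diag_neq0 u : u \in borel -> (e00 u != 0) && (e11 u != 0).
Proof.
rewrite inE => /eqP u10; have := GL2_det_neq0 u.
by rewrite u10 mulr0 subr0 mulf_eq0 negb_or.
Qed.

Lemma borel_sol : solvable borel.
Proof.
apply: (@solvable_commg_abelian _ _ [set upper t | t : F]).
  apply/centsP=> _ /imsetP[s _ ->] _ /imsetP[t _ ->].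
  by apply: GL2_ext; rewrite !GL2_mulE !upperE; ring.
(* Keep only x y = y x z for the commutator z. Diagonal entries of upper triangular matrices
   multiply, so those of z are 1. *)
move=> x y Bx By; have := commgC x y; move: ([~ x, y]%g) (groupR Bx By) => z Bz.
have /andP[x0 x1] := borel_diag_neq0 _ Bx; have /andP[y0 y1] := borel_diag_neq0 _ By.
move: Bx By Bz; rewrite !inE => /eqP x10 /eqP y10 /eqP z10 xyz.
suff -> : z = upper (e01 z) by apply: imset_f.
apply: GL2_ext; rewrite upperE //.
  apply: (mulfI (mulf_neq0 y0 x0)); move/(congr1 e00): xyz.
  by rewrite !GL2_mulE x10 y10 z10 !mulr0 !addr0 mulr1 mulrC => <-.
apply: (mulfI (mulf_neq0 y1 x1)); move/(congr1 e11): xyz.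
by rewrite !GL2_mulE x10 y10 !(mul0r, mulr0, add0r) mulr1 mulrC => <-.
Qed.

Lemma refl_solvable c u :
  c != 0 -> exists b, solvable <<[set refl c b; u]>>%g.
Proof.
move=> c0; have [Bu | nBu] := boolP (u \in borel).
  exists 0; apply: solvableS borel_sol.
  by rewrite gen_subG subUset !sub1set inE reflE ?eqxx.
have s0 : e10 u != 0 by rewrite inE in nBu.
(* The scalar matrix det u, so that z u^-1 is the adjugate of u. *)
pose D := e00 u * e11 u - e01 u * e10 u; pose z := gl2 D 0 0 D.
have zE : (e00 z = D) * (e01 z = 0) * (e10 z = 0) * (e11 z = D).
  by apply: gl2E; rewrite mulr0 subr0 mulf_neq0 ?GL2_det_neq0.
(* The root of tr ([refl c b] u) = c ([e00 u] + b [e10 u] - [e11 u]). *)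
pose b := (e11 u - e00 u) / e10 u; exists b.
apply: (@solvable_gen_invert _ _ _ z).
- by apply: GL2_ext; rewrite !GL2_mulE !zE; ring.
- by apply: GL2_ext; rewrite !GL2_mulE !zE; ring.
(* With x = [refl c b], the relation becomes u x u = x z, without inverses. *)
apply/(canRL (mulgK _))/(mulgI (refl c b)); rewrite mulgA -conjgC.
by apply: GL2_ext; rewrite !GL2_mulE !zE !reflE // /D /b; field.
Qed.

Lemma refl_inj c : c != 0 -> injective (refl c).
Proof. by move=> c0 b b' /(congr1 e01); rewrite !reflE // => /(mulfI c0). Qed.

(** Two members of the family differ by the left factor [upper (b - b')]. If it is central in SL_2,
    it commutes with [lower 1], which forces b = b'. *)
Lemma coset_refl_inj c :
    c != 0 -> (forall b, refl c b \in 'SL_2[F]) ->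
  injective (fun b => coset 'Z('SL_2[F])%g (refl c b)).
Proof.
move=> c0 SLx b b' eq_x; have NZ v : v \in 'SL_2[F] -> v \in 'N('Z('SL_2[F]))%g.
  exact/subsetP/gFnorm.
have /rcosetP[z Zz xz] : refl c b' \in ('Z('SL_2[F]) :* refl c b)%g.
  by rewrite -val_coset ?NZ // eq_x val_coset ?NZ ?rcoset_refl.
have zE : z = upper (b - b').
  apply: (mulIg (refl c b)); rewrite -xz.
  by apply: GL2_ext; rewrite !GL2_mulE !upperE !reflE //; ring.
have /centerP[_ /(_ _ (lower_in_SL 1))/(congr1 e00)] := Zz.
rewrite zE !GL2_mulE !upperE !lowerE !mulr1 mul0r addr0 => /eqP.
by rewrite -subr_eq0 addrC addKr subr_eq0 => /eqP.
Qed.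

(** The cyclic unit group has order divisible by 4, hence an element h of order 4; h^2 is a root of
    (X - 1) (X + 1) other than 1. *)
Lemma finField_sqrtN1 : #|F| = 1 %[mod 4] -> exists i : F, i ^+ 2 = -1.
Proof.
move=> F1; have [g gE] := cyclicP (field_unit_group_cyclic [set: {unit F}]%G).
have og : #[g]%g = #|F|.-1 by rewrite orderE -gE card_finField_unit.
have dv4 : (4 %| #[g]%g)%N.
  by rewrite og -subn1 -eqn_mod_dvd ?F1 //; apply/card_gt0P; exists 0.
pose h := (g ^+ (#[g] %/ 4))%g.
have oh : #[h]%g = 4%N.
  by rewrite orderXdiv ?dvdn_div // divnA // mulKn ?order_gt0.
exists (val h); apply/eqP; move: (expg_order h); rewrite oh.
move/(congr1 val); rewrite FinRing.val_unitX /= => h4.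
have : (val h ^+ 2 - 1) * (val h ^+ 2 + 1) == 0.
  by rewrite -subr_sqr expr1n -exprM h4 subrr.
rewrite mulf_eq0 subr_eq0 addr_eq0 => /orP[/eqP h2|//].
have /eqP : (h ^+ 2 = 1)%g by apply: val_inj; rewrite FinRing.val_unitX.
by rewrite -order_dvdn oh.
Qed.

(** * The coverings of GL_2 and PSL_2 *)

Lemma GL2_sol_covering :
    odd #|F| -> (3 < #|F|)%N ->
  sol_covering 'GL_2[F]%g [set refl 1 b | b : F].
Proof.
move=> oddF F3; have n1 : (1 : F) != 0 := oner_neq0 F.
apply/andP; split.
  apply/subsetP=> _ /imsetP[b _ ->]; rewrite !inE andbT.
  apply: contraL (sol_radical_sol 'GL_2[F]) => /nonsolvable_refl; apply=> //.
  by apply: subset_trans (normal_norm (sol_radical_normal _)); apply: subsetT.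
rewrite eqEsubset; apply/andP; split; apply/subsetP=> u _; last by rewrite inE.
have [b solb] := refl_solvable _ u n1.
by apply/bigcupP; exists (refl 1 b); rewrite ?imset_f // inE in_setT.
Qed.

Lemma sqrtN1_neq0 (i : F) : i ^+ 2 = -1 -> i != 0.
Proof.
by apply: contra_eq_neq => ->; rewrite expr0n /= eq_sym oppr_eq0 oner_eq0.
Qed.

Lemma refl_in_SL (i : F) b : i ^+ 2 = -1 -> refl i b \in 'SL_2[F]%g.
Proof.
move=> i2; rewrite in_SL2 !reflE ?sqrtN1_neq0 //.
by rewrite mulr0 subr0 mulrN -expr2 i2 opprK.
Qed.

Lemma PSL2_sol_covering (i : F) :
    odd #|F| -> (3 < #|F|)%N -> i ^+ 2 = -1 ->
  sol_covering 'PSL_2[F]%g [set coset 'Z('SL_2[F])%g (refl i b) | b : F].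
Proof.
move=> oddF F3 i2; have i0 := sqrtN1_neq0 i i2.
have SLx b := refl_in_SL i b i2.
have nZSL : 'Z('SL_2[F])%g <| 'SL_2[F] := center_normal _.
have NZ v : v \in 'SL_2[F] -> v \in 'N('Z('SL_2[F]))%g.
  exact/subsetP/normal_norm.
apply/andP; split.
  apply/subsetP=> _ /imsetP[b _ ->]; rewrite inE mem_quotient // andbT.
  (* The radical is pulled back to SL_2, where [nonsolvable_refl] applies; the preimage stays
     solvable because the centre is abelian. *)
  have solR := cosetpre_sol _ _ _ (abelian_sol (center_abelian 'SL_2[F]))
                 (sol_radical_sol 'PSL_2[F]).
  apply: contraL solR => Rx; apply: (nonsolvable_refl _ b i) => //.
    rewrite -{1}(quotientGK nZSL); apply: normal_norm.
    by rewrite cosetpre_normal sol_radical_normal.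
  by rewrite mem_morphpre //= NZ.
rewrite eqEsubset; apply/andP; split; apply/subsetP=> u.
  case/morphimP=> v Nv SLv ->; have [b solb] := refl_solvable _ v i0.
  apply/bigcupP; exists (coset 'Z('SL_2[F])%g (refl i b)); first exact: imset_f.
  by rewrite inE mem_quotient // quotient_gen2 ?NZ // quotient_sol.
by case/bigcupP=> x _ /[!inE] /andP[].
Qed.

End GL2.

Theorem theorem4p8 (q : nat) (F : finFieldType) (cardF : #|F| = q)
    (q_odd : odd q) (q_gt3 : 3 < q) :
  (exists2 X : {set {'GL_2[F]}}, sol_covering 'GL_2[F] X & #|X| = q)
  /\ (q = 1 %[mod 4] ->
      (exists2 X : {set coset_of 'Z('SL_2[F])},
         sol_covering 'PSL_2[F] X & #|X| = q)
      /\ sol_number 'PSL_2[F] <= q).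
Proof.
move: q_odd q_gt3; rewrite -cardF => oddF F3; split.
  exists [set refl F 1%R b | b : F]; first exact: GL2_sol_covering.
  by rewrite card_imset //; apply/refl_inj/oner_neq0.
move=> F1; have [i i2] := finField_sqrtN1 F F1.
have covX := PSL2_sol_covering F i oddF F3 i2.
have SLx b := refl_in_SL F i b i2.
have cardX := card_imset predT (coset_refl_inj F i (sqrtN1_neq0 F i i2) SLx).
split; last by rewrite -cardX; apply: sol_number_le.
by eexists; first exact: covX.
Qed.
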